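(* The derivation of a sub-tableau is valid; that is: if $\mathbf{T}'=(G,\mathcal{G}',\mathcal{M}',\mathcal{X}',\simeq')$ is a valid matroid tableau and the matroid tableau $\mathbf{T}=(G,\mathcal{G},\mathcal{M},\mathcal{X},\simeq)$ is a sub-tableau of $\mathbf{T}'$, then $\mathbf{T}$ is valid.
   Context: Matroids have finite ground sets. A digraph is a pair $D=(V,A)$ with $V$ finite and $A\subseteq V\times V$. A path in $D$ is a non-empty, non-repeating sequence of vertices $p_1p_2\ldots p_n$ with $(p_i,p_{i+1})\in A$ for $1\le i<n$. A routing from $X$ to $Y$ in $D$ is a family $R$ of paths in $D$ such that every $x\in X$ is the first vertex of some $p\in R$, every $p\in R$ ends in a vertex of $Y$, and any two distinct paths of $R$ are vertex-disjoint. For $E,T\subseteq V$, $\Gamma(D,T,E)$ is the matroid on $E$ whose independent sets are those $X\subseteq E$ for which there is a routing from $X$ to $T$ in $D$. A matroid $(E,\mathcal{I})$ is a gammoid if it equals $\Gamma(D,T,E)$ for some digraph $D=(V,A)$ with $E\subseteq V$ and some $T\subseteq V$; it is a strict gammoid if such a representation exists with $V=E$. A matroid tableau is a tuple $\mathbf{T}=(G,\mathcal{G},\mathcal{M},\mathcal{X},\simeq)$ where $G$ is a matroid (the goal), $\mathcal{G},\mathcal{M},\mathcal{X}$ are families of matroids, and $\simeq$ is an equivalence relation on $\{G'\mid G'\text{ is a minor of }G\}\cup\mathcal{G}\cup\mathcal{M}\cup\mathcal{X}$. $\mathbf{T}$ is valid if (i) all matroids in $\mathcal{G}$ are gammoids,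 (ii) no matroid in $\mathcal{M}$ is a strict gammoid, (iii) no matroid in $\mathcal{X}$ is a gammoid, and (iv) every equivalence class of $\simeq$ either consists only of gammoids or contains no gammoid. $\mathbf{T}=(G,\mathcal{G},\mathcal{M},\mathcal{X},\simeq)$ is a sub-tableau of $\mathbf{T}'=(G,\mathcal{G}',\mathcal{M}',\mathcal{X}',\simeq')$ (same goal $G$) if $\mathcal{G}\subseteq\mathcal{G}'$, $\mathcal{M}\subseteq\mathcal{M}'$, $\mathcal{X}\subseteq\mathcal{X}'$, and $M\simeq N$ implies $M\simeq' N$. *)

(* Defs.v *)
From mathcomp Require Import all_boot.
From mathcomp Require Import finmap.
From mathcomp Require Import boolp classical_sets cardinality.

Set Implicit Arguments.
Unset Strict Implicit.
Unset Printing Implicit Defensive.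

Local Open Scope fset_scope.

(* All ground sets and vertex sets are finite subsets of one universe U. The
   theorem takes U infinite, so that a digraph representing a gammoid may use
   any number of auxiliary vertices outside the ground set. *)

Record matroid (U : choiceType) := Matroid {
  ground : {fset U};
  indep : {fset {fset U}};
  indep_ground : forall X, X \in indep -> X `<=` ground;
  indep0 : fset0 \in indep;
  indep_sub : forall X Y, X `<=` Y -> Y \in indep -> X \in indep;
  indep_aug : forall X Y, X \in indep -> Y \in indep ->
    (#|` X| < #|` Y|)%N ->
    exists2 y, y \in Y `\` X & y |` X \in indep
}.

(* Leibniz equality of matroids is equality of the pairs (E, I). *)
Lemma matroid_ext (U : choiceType) (M N : matroid U) :
  ground M = ground N -> indep M = indep N -> M = N.
Proof.
case: M N => [E I a b c d] [E' I' a' b' c' d'] /= eE eI.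
by subst E' I'; congr Matroid; exact: Prop_irrelevance.
Qed.

Section Minors.
Variable U : choiceType.
Implicit Types (M N : matroid U) (X Y B C R : {fset U}).

Definition restrict_indep M R : {fset {fset U}} :=
  [fset X in indep M | X `<=` R].

Fact restrict_ground M R X :
  X \in restrict_indep M R -> X `<=` ground M `&` R.
Proof.
by rewrite !inE /= => /andP[/indep_ground XE XR]; rewrite fsubsetI XE.
Qed.

Fact restrict0 M R : fset0 \in restrict_indep M R.
Proof. by rewrite !inE /= indep0 fsub0set. Qed.

Fact restrict_sub M R X Y : X `<=` Y ->
  Y \in restrict_indep M R -> X \in restrict_indep M R.
Proof.
move=> XY; rewrite !inE /= => /andP[YI YR].
by rewrite (indep_sub XY YI) (fsubset_trans XY YR).
Qed.

Fact restrict_aug M R X Y :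
  X \in restrict_indep M R -> Y \in restrict_indep M R ->
  (#|` X| < #|` Y|)%N ->
  exists2 y, y \in Y `\` X & y |` X \in restrict_indep M R.
Proof.
rewrite !inE /= => /andP[XI XR] /andP[YI YR] ltXY.
have [y yYX yI] := indep_aug XI YI ltXY.
exists y => //; rewrite !inE /= yI fsubUset XR andbT fsub1set.
by move: yYX; rewrite inE => /andP[_ /(fsubsetP YR)].
Qed.

(* M | R *)
Definition restrict M R : matroid U :=
  Matroid (@restrict_ground M R) (@restrict0 M R) (@restrict_sub M R)
    (@restrict_aug M R).

Definition basis_of M C B : Prop :=
  [/\ B \in indep M, B `<=` C &
      forall B', B' \in indep M -> B' `<=` C -> B `<=` B' -> B' = B].

Definition contract_indep M C : {fset {fset U}} :=
  [fset X in fpowerset (ground M `\` C) |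
     `[< exists2 B, basis_of M C B & X `|` B \in indep M >]].

Lemma basis_of_card M C B B' : basis_of M C B -> basis_of M C B' ->
  #|` B| = #|` B'|.
Proof.
suff le B1 B2 : basis_of M C B1 -> basis_of M C B2 -> (#|` B2| <= #|` B1|)%N.
  by move=> b b'; apply/eqP; rewrite eqn_leq !le.
move=> [I1 S1 m1] [I2 S2 _]; rewrite leqNgt; apply/negP => lt.
have [y] := indep_aug I1 I2 lt; rewrite inE => /andP[yB1 yB2] yI.
have := m1 _ yI; rewrite fsubUset S1 fsub1set (fsubsetP S2 _ yB2) fsubsetU1.
by move=> /(_ isT isT) e; move: yB1; rewrite -e !inE eqxx.
Qed.

Lemma basis_of_exists M C : exists B, basis_of M C B.
Proof.
have [n] := ubnP (#|` C| - 0)%N.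
suff H k B : B \in indep M -> B `<=` C -> (#|` C| - #|` B| < k)%N ->
    exists B, basis_of M C B.
  by move=> lt; apply: (H n fset0); rewrite ?indep0 ?fsub0set ?cardfs0.
elim: k B => [//|k IH] B BI BC lt.
have [[B' [B'I B'C ltB]]|nex] :=
    EM (exists B', [/\ B' \in indep M, B' `<=` C & B `<` B']).
  apply: (IH B' B'I B'C).
  have := fproper_ltn_card ltB; have := fsubset_leq_card B'C => h1 h2.
  by rewrite ltnS in lt; apply: leq_trans lt; rewrite ltn_sub2l // (leq_trans h2).
exists B; split=> // B' B'I B'C BB'; apply/eqP; rewrite eq_sym.
apply/negPn/negP => neq; apply: nex; exists B'; split=> //.
by rewrite fproperEneq neq.
Qed.

Fact contract_ground M C X :
  X \in contract_indep M C -> X `<=` ground M `\` C.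
Proof. by rewrite !inE /= fpowersetE => /andP[]. Qed.

Fact contract0 M C : fset0 \in contract_indep M C.
Proof.
rewrite !inE /= fpowersetE fsub0set; apply/asboolP.
have [B bB] := basis_of_exists M C; exists B => //.
by rewrite fset0U; case: bB.
Qed.

Fact contract_sub M C X Y : X `<=` Y ->
  Y \in contract_indep M C -> X \in contract_indep M C.
Proof.
move=> XY; rewrite !inE /= !fpowersetE => /andP[YE /asboolP[B bB YB]].
rewrite (fsubset_trans XY YE); apply/asboolP; exists B => //.
by apply: indep_sub YB; apply: fsetSU.
Qed.

Fact contract_aug M C X Y :
  X \in contract_indep M C -> Y \in contract_indep M C ->
  (#|` X| < #|` Y|)%N ->
  exists2 y, y \in Y `\` X & y |` X \in contract_indep M C.
Proof.
rewrite !inE /= !fpowersetE.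
move=> /andP[XE /asboolP[B bB XB]] /andP[YE /asboolP[B' bB' YB']] ltXY.
have disj Z D : Z `<=` ground M `\` C -> basis_of M C D ->
    #|` Z `|` D| = (#|` Z| + #|` D|)%N.
  move=> ZE [_ DC _]; rewrite cardfsU.
  suff -> : Z `&` D = fset0 by rewrite cardfs0 subn0.
  apply/fsetP => z; rewrite !inE; apply/negP => /andP[/(fsubsetP ZE)].
  by rewrite inE => /andP[/negP zC _] /(fsubsetP DC).
have lt : (#|` X `|` B| < #|` Y `|` B'|)%N.
  by rewrite (disj _ _ XE bB) (disj _ _ YE bB') (basis_of_card bB bB') ltn_add2r.
have [y] := indep_aug XB YB' lt.
rewrite !inE negb_or => /andP[/andP[yX yB] yYB'] yI.
have [yY|yY] := boolP (y \in Y); last first.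
  move: yYB'; rewrite (negPf yY) /= => yB'.
  case: (bB) => BI BC Bmax; case: bB' => _ B'C _.
  have yBI : y |` B \in indep M.
    by apply: indep_sub yI; apply: fsetUS; apply: fsubsetUr.
  have := Bmax _ yBI; rewrite fsubUset BC fsub1set (fsubsetP B'C _ yB').
  move=> /(_ isT (fsubsetU1 _ _)) e.
  by move: yB; rewrite -e !inE eqxx.
exists y; first by rewrite inE yX.
rewrite !inE /= fpowersetE fsubUset XE fsub1set (fsubsetP YE _ yY).
by apply/asboolP; exists B => //; rewrite -fsetUA.
Qed.

(* M / C *)
Definition contract M C : matroid U :=
  Matroid (@contract_ground M C) (@contract0 M C) (@contract_sub M C)
    (@contract_aug M C).

(* Minors are taken on the nose, not up to isomorphism. *)
Definition minor M N : Prop :=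
  exists C R, [/\ C `<=` ground M, R `<=` ground M `\` C &
                  N = restrict (contract M C) R].

End Minors.

Record digraph (U : choiceType) := Digraph {
  vertices : {fset U};
  arcs : {fset U * U};
  arcs_vertices : arcs `<=` vertices `*` vertices
}.

Section Gammoids.
Variable U : choiceType.
Implicit Types (D : digraph U) (p q : seq U) (E T X Y : {fset U}).

Definition is_dipath D p : bool :=
  [&& p != [::], uniq p, all (mem (vertices D)) p &
      sorted (fun u v => (u, v) \in arcs D) p].

Definition starts_at p (x : U) : Prop := exists s, p = x :: s.
Definition ends_at p (y : U) : Prop := exists s, p = rcons s y.
Definition vertex_disjoint p q : bool := ~~ has (mem p) q.

(* A digraph has only finitely many paths, so a family of paths is a finite
   set. *)
Definition routing D X Y (R : {fset seq U}) : Prop :=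
  [/\ forall p, p \in R -> is_dipath D p,
      forall x, x \in X -> exists2 p, p \in R & starts_at p x,
      forall p, p \in R -> exists2 y, y \in Y & ends_at p y &
      forall p q, p \in R -> q \in R -> p != q -> vertex_disjoint p q].

(* The family of independent sets of Gamma(D, T, E). *)
Definition gamma_indep D T E : {fset {fset U}} :=
  [fset X in fpowerset E | `[< exists R, routing D X T R >]].

(* M = Gamma(D, T, E) *)
Definition is_gamma (M : matroid U) D T E : Prop :=
  ground M = E /\ indep M = gamma_indep D T E.

Definition gammoid (M : matroid U) : Prop :=
  exists D T E, [/\ E `<=` vertices D, T `<=` vertices D & is_gamma M D T E].

Definition strict_gammoid (M : matroid U) : Prop :=
  exists D T, T `<=` vertices D /\ is_gamma M D T (vertices D).

End Gammoids.

Local Open Scope classical_set_scope.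

Definition equivalence_on (A : Type) (S : set A) (r : A -> A -> Prop) : Prop :=
  [/\ forall x y, r x y -> S x /\ S y,
      forall x, S x -> r x x,
      forall x y, r x y -> r y x &
      forall x y z, r x y -> r y z -> r x z].

Definition tableau_support (U : choiceType) (G : matroid U)
    (GG MM XX : set (matroid U)) : set (matroid U) :=
  [set N | minor G N] `|` GG `|` MM `|` XX.

Record tableau (U : choiceType) := Tableau {
  goal : matroid U;
  tabG : set (matroid U);
  tabM : set (matroid U);
  tabX : set (matroid U);
  tab_equiv : matroid U -> matroid U -> Prop;
  tab_equivP : equivalence_on (tableau_support goal tabG tabM tabX) tab_equiv
}.

Definition tab_classes (U : choiceType) (T : tableau U) :
    set (set (matroid U)) :=
  [set K | exists2 M, tableau_support (goal T) (tabG T) (tabM T) (tabX T) M &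
                      K = [set N | tab_equiv T M N]].

Definition valid_tableau (U : choiceType) (T : tableau U) : Prop :=
  [/\ forall M, tabG T M -> gammoid M,
      forall M, tabM T M -> ~ strict_gammoid M,
      forall M, tabX T M -> ~ gammoid M &
      forall K, tab_classes T K ->
        (forall M, K M -> gammoid M) \/ (forall M, K M -> ~ gammoid M)].

Definition subtableau (U : choiceType) (T T' : tableau U) : Prop :=
  [/\ goal T = goal T',
      tabG T `<=` tabG T',
      tabM T `<=` tabM T',
      tabX T `<=` tabX T' &
      forall M N, tab_equiv T M N -> tab_equiv T' M N].

(* Main.v *)
Require Import Defs.
From mathcomp Require Import all_boot.
From mathcomp Require Import finmap.
From mathcomp Require Import boolp classical_sets cardinality.

(** The first three conditions pass to subfamilies. For the fourth, the class of [M] in [T] lies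
    inside the class of [M] in [T'], and both alternatives, all gammoids or no gammoid, pass to
    subsets. *)

Theorem lemma3p4 (U : choiceType) (Uinf : infinite_set [set: U]%classic)
    (T T' : tableau U) (HT' : valid_tableau T') (Hsub : subtableau T T') :
  valid_tableau T.
Proof.
case: HT' => gam' nstrict' ngam' class'.
case: Hsub => _ subG subM subX subE; split.
- by move=> M /subG /gam'.
- by move=> M /subM /nstrict'.
- by move=> M /subX /ngam'.
move=> _ [M SM ->].
have [_ refl _ _] := tab_equivP T.
have [supp' _ _ _] := tab_equivP T'.
(* Reflexivity in [T], carried over to [T'], puts [M] in the support of [T'], so [M] has a class
   there. *)
have [S'M _] := supp' _ _ (subE _ _ (refl _ SM)).
have [gamM|ngamM] := class' _ (ex_intro2 _ _ M S'M erefl).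
- by left=> N /subE /gamM.
- by right=> N /subE /ngamM.
Qed.
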